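(* $\mathbf{tHC}$ is sound and complete with respect to the class of finite subdirectly-irreducible temporal Heyting algebras.
   Context: Write $\mathsf{P}$ for the ''past diamond'' operator (black diamond). $\mathbf{mHC}$ is the smallest set of formulas in $\wedge,\vee,\to,\Box,\bot,\top$ containing intuitionistic propositional logic and $\Box(p\to q)\to(\Box p\to\Box q)$, $p\to\Box p$, $\Box p\to(q\vee(q\to p))$, closed under modus ponens and uniform substitution. $\mathbf{tHC}$ is the smallest set of formulas in the language extended with $\mathsf{P}$ containing $\mathbf{mHC}$ and $\mathsf{P}(p\vee q)\to(\mathsf{P}p\vee\mathsf{P}q)$, $\mathsf{P}\bot\to\bot$, $p\to\Box\mathsf{P}p$, $\mathsf{P}\Box p\to p$, closed under modus ponens, uniform substitution and the rule from $\varphi\to\chi$ infer $\mathsf{P}\varphi\to\mathsf{P}\chi$. A temporal Heyting algebra is a Heyting algebra with operators $\Box,\mathsf{P}$ such that $\Box(a\wedge b)=\Box a\wedge\Box b$, $a\le\Box a$, $\Box a\le b\vee(b\to a)$, and $\mathsf{P}a\le b\iff a\le\Box b$ (these form a variety); a formula is valid in it if it evaluates to $1$ under every valuation. *)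

(* Defs.v *)
From HB Require Import structures.
From mathcomp Require Import all_boot all_order.
From mathcomp Require Import classical_sets cardinality.

Set Implicit Arguments.
Unset Strict Implicit.
Unset Printing Implicit Defensive.

Local Open Scope order_scope.

Inductive form : Type :=
  | Var of nat
  | Bot
  | Top
  | And of form & form
  | Or of form & form
  | Imp of form & form
  | Box of form
  | Past of form.

Declare Scope form_scope.
Delimit Scope form_scope with F.
Bind Scope form_scope with form.
Local Notation "'\bot'" := Bot : form_scope.
Local Notation "'\top'" := Top : form_scope.
Local Infix "/\" := And : form_scope.
Local Infix "\/" := Or : form_scope.
Local Infix "->" := Imp : form_scope.
Local Notation "'□' A" := (Box A) (at level 35, right associativity) : form_scope.
Local Notation "'◆' A" := (Past A) (at level 35, right associativity) : form_scope.

Fixpoint ipc_form (A : form) : bool :=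
  match A with
  | Var _ | Bot | Top => true
  | And B C | Or B C | Imp B C => ipc_form B && ipc_form C
  | Box _ | Past _ => false
  end.

Fixpoint mhc_form (A : form) : bool :=
  match A with
  | Var _ | Bot | Top => true
  | And B C | Or B C | Imp B C => mhc_form B && mhc_form C
  | Box B => mhc_form B
  | Past _ => false
  end.

Fixpoint subst (s : nat -> form) (A : form) : form :=
  match A with
  | Var n => s n
  | Bot => Bot
  | Top => Top
  | And B C => And (subst s B) (subst s C)
  | Or B C => Or (subst s B) (subst s C)
  | Imp B C => Imp (subst s B) (subst s C)
  | Box B => Box (subst s B)
  | Past B => Past (subst s B)
  end.

Local Notation p := (Var 0).
Local Notation q := (Var 1).
Local Notation r := (Var 2).

Inductive IPC : form -> Prop :=
  | IPC_K : IPC (p -> (q -> p))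
  | IPC_S : IPC ((p -> (q -> r)) -> ((p -> q) -> (p -> r)))
  | IPC_andl : IPC (p /\ q -> p)
  | IPC_andr : IPC (p /\ q -> q)
  | IPC_andI : IPC (p -> (q -> p /\ q))
  | IPC_orl : IPC (p -> p \/ q)
  | IPC_orr : IPC (q -> p \/ q)
  | IPC_orE : IPC ((p -> r) -> ((q -> r) -> (p \/ q -> r)))
  | IPC_bot : IPC (\bot -> p)
  | IPC_top : IPC \top
  | IPC_mp A B : IPC (A -> B) -> IPC A -> IPC B
  | IPC_subst s A :
      (forall n, ipc_form (s n)) -> IPC A -> IPC (subst s A).

(** Substitutions range over the language of the logic being defined, so that
    [mHC] is a set of [Past]-free formulas. *)
Inductive mHC : form -> Prop :=
  | mHC_IPC A : IPC A -> mHC A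
  | mHC_K : mHC (□(p -> q) -> (□p -> □q))
  | mHC_T : mHC (p -> □p)
  | mHC_D : mHC (□p -> q \/ (q -> p))
  | mHC_mp A B : mHC (A -> B) -> mHC A -> mHC B
  | mHC_subst s A :
      (forall n, mhc_form (s n)) -> mHC A -> mHC (subst s A).

Inductive tHC : form -> Prop :=
  | tHC_mHC A : mHC A -> tHC A
  | tHC_or : tHC (◆(p \/ q) -> ◆p \/ ◆q)
  | tHC_bot : tHC (◆\bot -> \bot)
  | tHC_unit : tHC (p -> □◆p)
  | tHC_counit : tHC (◆□p -> p)
  | tHC_mp A B : tHC (A -> B) -> tHC A -> tHC B
  | tHC_subst s A : tHC A -> tHC (subst s A)
  | tHC_past A B : tHC (A -> B) -> tHC (◆A -> ◆B).

HB.mixin Record TBLattice_isHeyting (d : Order.disp_t) T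
    of Order.TBLattice d T := {
  himp : T -> T -> T;
  le_himp : forall c a b : T, (c <= himp a b) = (c `&` a <= b)
}.

#[short(type="heytingType")]
HB.structure Definition Heyting (d : Order.disp_t) :=
  { T of TBLattice_isHeyting d T & Order.TBLattice d T }.

HB.mixin Record Heyting_isTemporal (d : Order.disp_t) T of Heyting d T := {
  hbox : T -> T;
  hpast : T -> T;
  hboxI : forall a b : T, hbox (a `&` b) = hbox a `&` hbox b;
  le_hbox : forall a : T, a <= hbox a;
  hbox_le : forall a b : T, hbox a <= b `|` himp b a;
  hpast_hbox : forall a b : T, (hpast a <= b) = (a <= hbox b)
}.

#[short(type="temporalHeytingType")]
HB.structure Definition TemporalHeyting (d : Order.disp_t) :=
  { T of Heyting_isTemporal d T & Heyting d T }.

Fixpoint eval (d : Order.disp_t) (H : temporalHeytingType d) (v : nat -> H)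
    (A : form) : H :=
  match A with
  | Var n => v n
  | Bot => \bot
  | Top => \top
  | And B C => eval v B `&` eval v C
  | Or B C => eval v B `|` eval v C
  | Imp B C => himp (eval v B) (eval v C)
  | Box B => hbox (eval v B)
  | Past B => hpast (eval v B)
  end.

Definition valid (d : Order.disp_t) (H : temporalHeytingType d) (A : form) :=
  forall v : nat -> H, eval v A = \top.

Definition is_hom (d d' : Order.disp_t) (G : temporalHeytingType d)
    (H : temporalHeytingType d') (f : G -> H) : Prop :=
  [/\ f \bot = \bot /\ f \top = \top,
      {morph f : a b / a `&` b >-> a `&` b},
      {morph f : a b / a `|` b >-> a `|` b},
      {morph f : a b / himp a b >-> himp a b} &
      {morph f : a / hbox a >-> hbox a} /\
      {morph f : a / hpast a >-> hpast a}].

(** The family [f] stands for the map [x |-> (f i x)_i] into the product of the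
    [K i], whose operations are coordinatewise: that map is a homomorphism iff
    each [f i] is, and it is injective iff the [f i] jointly separate points. *)
Definition subdirect_embedding (d : Order.disp_t) (H : temporalHeytingType d)
    (I : Type) (e : I -> Order.disp_t) (K : forall i, temporalHeytingType (e i))
    (f : forall i, H -> K i) : Prop :=
  [/\ forall i, is_hom (f i),
      forall x y : H, (forall i, f i x = f i y) -> x = y &
      forall i (y : K i), exists x : H, f i x = y].

(** [I] may be empty, so the one-element algebra is not subdirectly
    irreducible. A bijective homomorphism is an isomorphism. *)
Definition subdirectly_irreducible (d : Order.disp_t)
    (H : temporalHeytingType d) : Prop :=
  forall (I : Type) (e : I -> Order.disp_t)
    (K : forall i, temporalHeytingType (e i)) (f : forall i, H -> K i),
    subdirect_embedding f -> exists i, bijective (f i).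

(* Main.v *)
(** Completeness rests on a finite canonical frame whose points are the subsets
    [t] of the subformulas of [A] such that the conjunction of [t] does not
    entail the disjunction of its complement. Put [t] below [u] when [t] is
    included in [u], [□B] in [t] forces [B] in [u], and [B] in [t] forces [◆B]
    in [u] (for [◆B] a subformula); this transitive relation interprets the
    modalities, and its reflexive closure interprets implication. That reflexive
    closure suffices is due to [□p -> q \/ (q -> p)]: if [B -> C] and [B] are
    both outside [t], then [t] has a witness above it in the modal sense. The
    upsets of the frame form a finite temporal Heyting algebra refuting [A]
    whenever [A] is not a theorem, and a smallest algebra refuting [A] is
    subdirectly irreducible. *)

From HB Require Import structures.
Require Import Defs.
From mathcomp Require Import boolp classical_sets cardinality.
From mathcomp Require Import all_boot all_order.

Set Implicit Arguments.
Unset Strict Implicit.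
Unset Printing Implicit Defensive.

Import Order.Theory.

Local Open Scope order_scope.

(** * Soundness *)

Section HeytingTheory.
Variables (d : Order.disp_t) (H : temporalHeytingType d).
Implicit Types a b c : H.

Lemma himp_eq1 a b : (himp a b == \top) = (a <= b).
Proof. by rewrite -le1x le_himp meet1x. Qed.

Lemma himpP a b : himp a b = \top <-> a <= b.
Proof. by rewrite -himp_eq1; split=> [->|/eqP]. Qed.

Lemma meet_himp_le a b : himp a b `&` a <= b.
Proof. by rewrite -le_himp. Qed.

Lemma hpast_mono a b : a <= b -> hpast a <= hpast b.
Proof. by move=> ab; rewrite hpast_hbox (le_trans ab) -?hpast_hbox. Qed.

(** Monotonicity of [hbox] comes from the adjunction, through the counit [hpast (hbox c) <= c]. *)
Lemma hbox_himp a b : hbox (himp a b) `&` hbox a <= hbox b.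
Proof. by rewrite -hboxI -hpast_hbox (le_trans _ (meet_himp_le a b)) ?hpast_hbox. Qed.

Lemma eval_subst (v : nat -> H) s A :
  eval v (subst s A) = eval (fun n => eval v (s n)) A.
Proof. by elim: A => //= [B -> C ->|B -> C ->|B -> C ->|B ->|B ->]. Qed.

Lemma valid_mp A B : valid H (Imp A B) -> valid H A -> valid H B.
Proof.
move=> AB HA v; apply/eqP; rewrite -le1x -(HA v).
by apply/himpP; exact: AB.
Qed.

Lemma valid_subst s A : valid H A -> valid H (subst s A).
Proof. by move=> HA v; rewrite eval_subst. Qed.

Lemma IPC_sound A : IPC A -> valid H A.
Proof.
elim=> [||||||||||B C _ + _|s B _ _]; [| | | | | | | | | |exact: valid_mp|exact: valid_subst];
  move=> v //=; apply/himpP.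
- by rewrite le_himp leIl.
- rewrite !le_himp; set x := v 0%N; set y := v 1%N; set z := v 2%N.
  apply: (le_trans _ (meet_himp_le y z)); rewrite lexI; apply/andP; split.
    apply: (le_trans _ (meet_himp_le x _)); rewrite lexI leIr andbT.
    by rewrite -meetA leIl.
  apply: (le_trans _ (meet_himp_le x _)); rewrite lexI leIr andbT.
  by rewrite -meetA meetCA leIl.
- exact: leIl.
- exact: leIr.
- by rewrite le_himp.
- exact: leUl.
- exact: leUr.
- rewrite !le_himp meetC -le_himp leUx; apply/andP; split; rewrite le_himp.
    by rewrite meetA (le_trans (leIl _ _)) // meetC meet_himp_le.
  by rewrite meetCA (le_trans (leIr _ _)) // meetC meet_himp_le.
- exact: le0x.
Qed.

Lemma mHC_sound A : mHC A -> valid H A.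
Proof.
elim=> [B /IPC_sound//||||B C _ + _|s B _ _];
  [| | |exact: valid_mp|exact: valid_subst]; move=> v /=; apply/himpP.
- by rewrite le_himp hbox_himp.
- exact: le_hbox.
- exact: hbox_le.
Qed.

(** As a left adjoint, [hpast] is monotone and preserves joins and bottom; the other two axioms are
    the unit and the counit. *)
Lemma tHC_sound A : tHC A -> valid H A.
Proof.
elim=> [B /mHC_sound//|||||B C _ + _|s B _|B C _ HBC];
  [| | | |exact: valid_mp|exact: valid_subst|];
  move=> v /=; apply/himpP.
- by rewrite hpast_hbox leUx -!hpast_hbox leUl leUr.
- by rewrite hpast_hbox le0x.
- by rewrite -hpast_hbox.
- by rewrite hpast_hbox.
- by apply: hpast_mono; apply/himpP; exact: HBC.
Qed.

End HeytingTheory.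

(** * Reduction to subdirectly irreducible algebras *)

Lemma eval_hom (d d' : Order.disp_t) (G : temporalHeytingType d)
    (H : temporalHeytingType d') (f : G -> H) (v : nat -> G) A :
  is_hom f -> eval (f \o v) A = f (eval v A).
Proof.
case=> -[f0 f1] fI fU fimp [fbox fpast].
by elim: A => //= [B -> C ->|B -> C ->|B -> C ->|B ->|B ->].
Qed.

Lemma inj_surj_bij (T : choiceType) (T' : eqType) (f : T -> T') :
  injective f -> (forall y, exists x, f x = y) -> bijective f.
Proof.
move=> finj fsurj.
have fsurjb y : exists x, f x == y by have [x <-] := fsurj y; exists x.
have fg : cancel (fun y => xchoose (fsurjb y)) f.
  by move=> y; apply/eqP/(xchooseP (fsurjb y)).
by exists (fun y => xchoose (fsurjb y)) => // x; exact/finj/fg.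
Qed.

(* A refuting algebra covered by a shortest possible list is subdirectly
   irreducible: some coordinate of a subdirect embedding still refutes [A], and
   were it not injective its codomain would be covered by a shorter list. *)
Lemma valid_finite_of_si A :
  (forall (d : Order.disp_t) (H : temporalHeytingType d),
     finite_set [set: H]%classic -> subdirectly_irreducible H -> valid H A) ->
  forall (d : Order.disp_t) (H : temporalHeytingType d),
    finite_set [set: H]%classic -> valid H A.
Proof.
move=> Asi.
(* The claim ranges over all algebras because the induction passes from [H] to a factor [K i]. *)
suff cover n (d : Order.disp_t) (H : temporalHeytingType d) (s : seq H) :
    (size s < n)%N -> (forall x, x \in s) -> valid H A.
  move=> d H /finite_seqP[s Hs]; apply: (cover (size s).+1 d H s) => // x.
  by have : [set: H]%classic x by []; rewrite Hs.
elim: n => // n IHn in d H s * => sn sH.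
have [//|/existsNP[v HA]] := pselect (valid H A).
apply: Asi.
  by apply/finite_seqP; exists s; apply/seteqP; split=> x //= _.
move=> I e K f [fhom fsep fsurj].
have /existsNP[i fi] : ~ forall i, f i (eval v A) = f i \top.
  by move=> fA; apply: HA; exact: fsep.
exists i; apply: inj_surj_bij (fsurj i) => x y fxy; apply/eqP/negPn/negP => xy.
apply: fi; rewrite -(eval_hom _ _ (fhom i)).
have [[_ ->] _ _ _ _] := fhom i.
(* Dropping [x] loses nothing: its image is also that of [y], which stays in the list. *)
apply: (IHn _ (K i) [seq f i z | z <- s & z != x]) => [|z].
  rewrite size_map size_filter -ltnS (leq_trans _ sn) // ltnS.
  rewrite -(count_predC (pred1 x) s) -[X in (X < _)%N]add0n ltn_add2r.
  by rewrite -has_count has_pred1.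
have [t <-] := fsurj i z.
have [->|tx] := eqVneq t x.
  by rewrite fxy map_f // mem_filter sH eq_sym xy.
by rewrite map_f // mem_filter tx sH.
Qed.

(** * The algebra of upsets of a finite temporal frame *)

(* [frel] is the accessibility relation of the modalities; the intuitionistic
   order is its reflexive closure. It may fail to be antisymmetric, which is
   harmless as only upsets matter. *)
Record tframe := TFrame {
  fsort :> finType;
  frel : rel fsort;
  frel_trans : transitive frel
}.

Definition is_upset (F : tframe) (U : {set F}) :=
  [forall x in U, forall y, frel x y ==> (y \in U)].

Lemma is_upsetP (F : tframe) (U : {set F}) :
  reflect (forall x y, frel x y -> x \in U -> y \in U) (is_upset U).
Proof.
apply: (iffP idP) => [/forall_inP UP x y xy /UP/forallP/(_ y)/implyP->//|UP].
by apply/forall_inP => x xU; apply/forallP => y; apply/implyP => /UP; apply.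
Qed.

Fact upset_display : Order.disp_t.
Proof. exact: (Order.Disp tt tt). Qed.

Record upset (F : tframe) := Upset { uset :> {set F}; _ : is_upset uset }.

HB.instance Definition _ (F : tframe) := [isSub for @uset F].
HB.instance Definition _ (F : tframe) := [Finite of upset F by <:].

Section Upset.
Variable F : tframe.
Implicit Types (U V : upset F) (x y : F).

Lemma upsetP U x y : frel x y -> x \in uset U -> y \in uset U.
Proof. by case: U => U /= /is_upsetP; apply. Qed.

Fact upset0_subproof : is_upset (set0 : {set F}).
Proof. by apply/is_upsetP => x y _; rewrite inE. Qed.

Fact upsetT_subproof : is_upset [set: F].
Proof. by apply/is_upsetP => x y _; rewrite !inE. Qed.

Fact upsetI_subproof U V : is_upset (uset U :&: uset V).
Proof.
by apply/is_upsetP => x y xy; rewrite !inE => /andP[xU xV]; rewrite !(upsetP xy).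
Qed.

Fact upsetU_subproof U V : is_upset (uset U :|: uset V).
Proof.
apply/is_upsetP => x y xy; rewrite !inE.
by case/orP => /(upsetP xy)->; rewrite ?orbT.
Qed.

Fact upset_imp_subproof U V :
  is_upset [set x | [forall y, ((y == x) || frel x y) && (y \in uset U)
                       ==> (y \in uset V)]].
Proof.
apply/is_upsetP => x y xy; rewrite !inE => /forallP xUV; apply/forallP => z.
apply/implyP => /andP[yz zU]; apply: (implyP (xUV z)); rewrite zU andbT.
by case/orP: yz => [/eqP->|/(frel_trans xy)->]; rewrite ?xy orbT.
Qed.

Fact upset_box_subproof U : is_upset [set x | [forall y, frel x y ==> (y \in uset U)]].
Proof.
apply/is_upsetP => x y xy; rewrite !inE => /forallP xU; apply/forallP => z.
by apply/implyP => /(frel_trans xy); exact/implyP.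
Qed.

Fact upset_past_subproof U : is_upset [set y | [exists x in uset U, frel x y]].
Proof.
apply/is_upsetP => x y xy; rewrite !inE => /exists_inP[z zU zx].
by apply/exists_inP; exists z => //; exact: frel_trans xy.
Qed.

Definition upset_imp U V := Upset (upset_imp_subproof U V).
Definition upset_box U := Upset (upset_box_subproof U).
Definition upset_past U := Upset (upset_past_subproof U).

Let le U V := uset U \subset uset V.

Fact upset_le_refl : reflexive le.
Proof. by move=> U; exact: subxx. Qed.

Fact upset_le_anti : antisymmetric le.
Proof. by move=> U V UV; apply/val_inj/eqP; rewrite eqEsubset. Qed.

Fact upset_le_trans : transitive le.
Proof. by move=> U V W; exact: subset_trans. Qed.

HB.instance Definition _ := Order.Le_isPOrder.Build upset_display (upset F)
  upset_le_refl upset_le_anti upset_le_trans.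

Fact upset_lexI U V W : le U (Upset (upsetI_subproof V W)) = le U V && le U W.
Proof. exact: subsetI. Qed.

Fact upset_leUx U V W : le (Upset (upsetU_subproof U V)) W = le U W && le V W.
Proof. exact: subUset. Qed.

Fact upset_le0x U : le (Upset upset0_subproof) U.
Proof. exact: sub0set. Qed.

Fact upset_lex1 U : le U (Upset upsetT_subproof).
Proof. exact: subsetT. Qed.

HB.instance Definition _ := Order.POrder_isMeetSemilattice.Build
  upset_display (upset F) upset_lexI.
HB.instance Definition _ := Order.POrder_isJoinSemilattice.Build
  upset_display (upset F) upset_leUx.
HB.instance Definition _ := Order.hasBottom.Build
  upset_display (upset F) upset_le0x.
HB.instance Definition _ := Order.hasTop.Build
  upset_display (upset F) upset_lex1.

(** Left to right uses the reflexive pair [y = x], right to left the upward closure of [W]. *)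
Lemma le_upset_imp (W U V : upset F) : (W <= upset_imp U V) = (W `&` U <= V).
Proof.
apply/subsetP/subsetP => WUV x.
  rewrite !inE => /andP[/WUV]; rewrite inE => /forallP/(_ x)/implyP + xU.
  by apply; rewrite eqxx.
move=> xW; rewrite inE; apply/forallP => y; apply/implyP => /andP[xy yU].
apply: WUV; rewrite inE yU andbT.
by case/orP: xy => [/eqP->//|/upsetP]; apply.
Qed.

HB.instance Definition _ := TBLattice_isHeyting.Build
  upset_display (upset F) le_upset_imp.

Lemma upset_boxI U V : upset_box (U `&` V) = upset_box U `&` upset_box V.
Proof.
apply/val_inj/setP => x; rewrite !inE; apply/forallP/andP => [xUV|[]].
  split; apply/forallP => y; apply/implyP => /(implyP (xUV y)); rewrite inE.
    by case/andP.
  by case/andP.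
move=> /forallP xU /forallP xV y; apply/implyP => xy; rewrite inE.
by rewrite (implyP (xU y) xy) (implyP (xV y) xy).
Qed.

Lemma le_upset_box U : U <= upset_box U.
Proof.
apply/subsetP => x xU; rewrite inE; apply/forallP => y; apply/implyP => xy.
exact: upsetP xU.
Qed.

(** At a point outside [V] the implication is vacuous at the point itself, and every
    [frel]-successor already lies in [U]. *)
Lemma upset_box_le U V : upset_box U <= V `|` himp V U.
Proof.
apply/subsetP => x; rewrite !inE => /forallP xU; apply/orP.
have [|xV] := boolP (x \in uset V); [by left|right].
apply/forallP => y; apply/implyP => /andP[/orP[/eqP->|xy _]].
  by rewrite (negPf xV).
exact: implyP xy.
Qed.

(** Both sides say that every [frel]-successor of a point of [U] lies in [V]. *)
Lemma upset_past_box U V : (upset_past U <= V) = (U <= upset_box V).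
Proof.
apply/subsetP/subsetP => UV x.
  move=> xU; rewrite inE; apply/forallP => y; apply/implyP => xy.
  by apply: UV; rewrite inE; apply/exists_inP; exists x.
by rewrite inE => /exists_inP[y /UV]; rewrite inE => /forallP/(_ x)/implyP; apply.
Qed.

HB.instance Definition _ := Heyting_isTemporal.Build
  upset_display (upset F) upset_boxI le_upset_box upset_box_le upset_past_box.

End Upset.

(** * Derived rules of tHC *)

Definition entails A B := tHC (Imp A B).

Section Entailment.
Implicit Types A B C D : form.

Let inst A B C n :=
  match n with 0%N => A | 1%N => B | _ => C end.

(** Substituting in [tHC] lets [A], [B] and [C] contain [Past], which the substitution rules of
    [IPC] and [mHC] exclude. *)
Lemma tHC_inst A B C E : IPC E -> tHC (subst (inst A B C) E).
Proof. by move=> HE; apply/tHC_subst/tHC_mHC/mHC_IPC. Qed.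

Lemma tHC_impK A B : tHC A -> tHC (Imp B A).
Proof. by move=> HA; apply: tHC_mp HA; exact: (tHC_inst A B Top IPC_K). Qed.

Lemma entails_mp A B C : entails A (Imp B C) -> entails A B -> entails A C.
Proof.
move=> ABC AB; apply: tHC_mp AB; apply: tHC_mp ABC.
exact: (tHC_inst A B C IPC_S).
Qed.

Lemma entails_trans B A C : entails A B -> entails B C -> entails A C.
Proof. by move=> AB BC; apply: entails_mp AB; exact: tHC_impK. Qed.

Lemma entails_refl A : entails A A.
Proof.
apply: (@entails_mp A (Imp Top A) A).
  exact: (tHC_inst A (Imp Top A) Top IPC_K).
exact: (tHC_inst A Top Top IPC_K).
Qed.

Lemma entails_andl A B : entails (And A B) A.
Proof. exact: (tHC_inst A B Top IPC_andl). Qed.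

Lemma entails_andr A B : entails (And A B) B.
Proof. exact: (tHC_inst A B Top IPC_andr). Qed.

Lemma entails_and C A B : entails C A -> entails C B -> entails C (And A B).
Proof.
move=> CA CB; apply: entails_mp CB; apply: entails_trans CA _.
exact: (tHC_inst A B Top IPC_andI).
Qed.

Lemma entails_orl A B : entails A (Or A B).
Proof. exact: (tHC_inst A B Top IPC_orl). Qed.

Lemma entails_orr A B : entails B (Or A B).
Proof. exact: (tHC_inst A B Top IPC_orr). Qed.

Lemma entails_or A B C : entails A C -> entails B C -> entails (Or A B) C.
Proof.
move=> hA hB; apply: tHC_mp hB; apply: tHC_mp hA.
exact: (tHC_inst A B C IPC_orE).
Qed.

Lemma entails_bot A : entails Bot A.
Proof. exact: (tHC_inst A Top Top IPC_bot). Qed.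

Lemma entails_top A : entails A Top.
Proof. exact/tHC_impK/tHC_mHC/mHC_IPC/IPC_top. Qed.

Lemma entails_imp A B C : entails (And A B) C -> entails A (Imp B C).
Proof.
move=> ABC; apply: (@entails_trans (Imp B (And A B))).
  exact: (tHC_inst A B Top IPC_andI).
apply: (@tHC_mp (Imp B (Imp (And A B) C))); last exact: tHC_impK.
exact: (tHC_inst B (And A B) C IPC_S).
Qed.

(** A cut on a disjunction that retains the context [A]; [saturate] relies on it. *)
Lemma entails_or_and A B C D :
  entails A (Or B C) -> entails (And A B) D -> entails (And A C) D -> entails A D.
Proof.
move=> ABC ABD ACD; apply: (@entails_mp A A); last exact: entails_refl.
apply: entails_trans ABC _; apply: entails_or; apply: entails_imp.
  by apply: entails_trans ABD; apply: entails_and;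
    [exact: entails_andr|exact: entails_andl].
by apply: entails_trans ACD; apply: entails_and;
  [exact: entails_andr|exact: entails_andl].
Qed.

Lemma entails_boxT A : entails A (Box A).
Proof. exact: (tHC_subst (inst A Top Top) (tHC_mHC mHC_T)). Qed.

Lemma entails_box_imp A B : entails (Box A) (Or B (Imp B A)).
Proof. exact: (tHC_subst (inst A B Top) (tHC_mHC mHC_D)). Qed.

Lemma entails_boxK A B : entails (Box (Imp A B)) (Imp (Box A) (Box B)).
Proof. exact: (tHC_subst (inst A B Top) (tHC_mHC mHC_K)). Qed.

(** The axiom [p -> □p] supplies necessitation for the implication. *)
Lemma entails_box A B : entails A B -> entails (Box A) (Box B).
Proof.
move=> AB; apply: (@tHC_mp (Box (Imp A B))); first exact: entails_boxK.
by apply: tHC_mp AB; exact: entails_boxT.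
Qed.

Lemma entails_box_and A B : entails (And (Box A) (Box B)) (Box (And A B)).
Proof.
apply: entails_mp (entails_andr _ _); apply: entails_trans (entails_andl _ _) _.
apply: entails_trans (entails_boxK _ _); apply: entails_box.
exact/entails_imp/entails_refl.
Qed.

(** The syntactic adjunction, from unit, counit and monotonicity; all later reasoning about [Past]
    goes through it. *)
Lemma entails_past_box A B : entails (Past A) B <-> entails A (Box B).
Proof.
split=> [/entails_box|/tHC_past AB].
  by apply: entails_trans; exact: (tHC_subst (inst A Top Top) tHC_unit).
by apply: entails_trans AB _; exact: (tHC_subst (inst B Top Top) tHC_counit).
Qed.

Lemma entails_box_past A : entails A (Box (Past A)).
Proof. exact/entails_past_box/entails_refl. Qed.

End Entailment.

HB.instance Definition _ := gen_eqMixin form.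
HB.instance Definition _ := gen_choiceMixin form.

(** * Finite conjunctions and disjunctions, and saturation *)

Definition bigand (G : seq form) := foldr And Top G.
Definition bigor (G : seq form) := foldr Or Bot G.

Lemma bigand_entails G A : A \in G -> entails (bigand G) A.
Proof.
elim: G => //= B G IHG; rewrite inE => /orP[/eqP->|/IHG].
  exact: entails_andl.
exact/entails_trans/entails_andr.
Qed.

Lemma entails_bigand G A : (forall B, B \in G -> entails A B) -> entails A (bigand G).
Proof.
elim: G => [_|B G IHG AG] /=; first exact: entails_top.
apply: entails_and; first by apply: AG; rewrite mem_head.
by apply: IHG => C CG; apply: AG; rewrite inE CG orbT.
Qed.

Lemma entails_bigor G A : A \in G -> entails A (bigor G).
Proof.
elim: G => //= B G IHG; rewrite inE => /orP[/eqP->|/IHG AG].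
  exact: entails_orl.
exact: entails_trans AG (entails_orr _ _).
Qed.

Lemma bigor_entails G A : (forall B, B \in G -> entails B A) -> entails (bigor G) A.
Proof.
elim: G => [_|B G IHG AG] /=; first exact: entails_bot.
apply: entails_or; first by apply: AG; rewrite mem_head.
by apply: IHG => C CG; apply: AG; rewrite inE CG orbT.
Qed.

Lemma entails_box_bigand G A :
  (forall B, B \in G -> entails A (Box B)) -> entails A (Box (bigand G)).
Proof.
elim: G => [_|B G IHG AG] /=.
  exact: entails_trans (entails_top _) (entails_boxT _).
apply: entails_trans (entails_box_and _ _).
apply: entails_and; first by apply: AG; rewrite mem_head.
by apply: IHG => C CG; apply: AG; rewrite inE CG orbT.
Qed.

Lemma sub_bigand G G' : {subset G' <= G} -> entails (bigand G) (bigand G').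
Proof. by move=> GG'; apply: entails_bigand => B /GG'; exact: bigand_entails. Qed.

Lemma sub_bigor G G' : {subset G <= G'} -> entails (bigor G) (bigor G').
Proof. by move=> GG'; apply: bigor_entails => B /GG'; exact: entails_bigor. Qed.

(** A finite Lindenbaum lemma: by cut, each formula of [S] can join the left or the right side
    without making the entailment derivable. *)
Lemma saturate (S G D : seq form) : ~ entails (bigand G) (bigor D) ->
  exists G' D', [/\ {subset G <= G'}, {subset D <= D'},
    ~ entails (bigand G') (bigor D') & forall A, A \in S -> (A \in G') || (A \in D')].
Proof.
elim: S => [|A S IHS] in G D * => GD; first by exists G, D; split.
have [AGD|AGD] := pselect (entails (bigand (A :: G)) (bigor D)).
  have [|G' [D' [GG' DD' GD' SGD]]] := IHS G (A :: D).
    move=> GAD; apply: GD; apply: entails_or_and GAD _ _ => /=.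
      by apply: entails_trans AGD; apply: entails_and;
        [exact: entails_andr|exact: entails_andl].
    exact: entails_andr.
  exists G', D'; split=> // [B BD|B].
    by rewrite DD' // inE BD orbT.
  by rewrite inE => /orP[/eqP->|/SGD//]; rewrite DD' ?mem_head ?orbT.
have [G' [D' [GG' DD' GD' SGD]]] := IHS _ _ AGD.
exists G', D'; split=> // [B BG|B].
  by rewrite GG' // inE BG orbT.
by rewrite inE => /orP[/eqP->|/SGD//]; rewrite GG' ?mem_head.
Qed.

(** * The finite canonical frame *)

Definition children_in (S : seq form) A : Prop :=
  match A with
  | Var _ | Bot | Top => True
  | And B C | Or B C | Imp B C => B \in S /\ C \in S
  | Box B | Past B => B \in S
  end.

Definition subclosed (S : seq form) := forall A, A \in S -> children_in S A.

Fixpoint subforms A : seq form :=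
  A :: match A with
       | Var _ | Bot | Top => [::]
       | And B C | Or B C | Imp B C => subforms B ++ subforms C
       | Box B | Past B => subforms B
       end.

Lemma mem_subforms A : A \in subforms A.
Proof. by case: A => *; rewrite /= mem_head. Qed.

Lemma subforms_closed A : subclosed (subforms A).
Proof.
have weaken (S S' : seq form) B :
    {subset S <= S'} -> children_in S B -> children_in S' B.
  by move=> SS'; case: B => //= B C [BS CS]; split; exact: SS'.
have two B C S : {subset subforms B ++ subforms C <= S} -> B \in S /\ C \in S.
  by move=> BCS; split; apply: BCS; rewrite mem_cat mem_subforms ?orbT.
elim: A => [n|||B IHB C IHC|B IHB C IHC|B IHB C IHC|B IHB|B IHB] A /=;
  rewrite in_cons => /orP[/eqP->//|] //.
1,3,5: by apply: two => D DS; rewrite in_cons DS orbT.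
1-3: by rewrite mem_cat => /orP[/IHB|/IHC]; apply: weaken => D DS;
  rewrite in_cons mem_cat DS !orbT.
1,3: by rewrite /= in_cons mem_subforms orbT.
1-2: by move=> /IHB; apply: weaken => D DS; rewrite in_cons DS orbT.
Qed.

Section Canonical.
Variables (S : seq form) (S_closed : subclosed S).

(** Extends membership in [t] to every formula, with value false outside [S]. *)
Definition holds (t : {set seq_sub S}) A := [exists a in t, ssval a == A].

Lemma holds_in t A : holds t A -> A \in S.
Proof. by case/exists_inP => a _ /eqP <-; exact: ssvalP. Qed.

Definition pos t := [seq A <- S | holds t A].
Definition neg t := [seq A <- S | ~~ holds t A].

Lemma mem_pos t A : (A \in pos t) = holds t A.
Proof. by rewrite mem_filter andb_idr //; exact: holds_in. Qed.

Lemma mem_neg t A : (A \in neg t) = ~~ holds t A && (A \in S).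
Proof. exact: mem_filter. Qed.

Definition consistent t := ~ entails (bigand (pos t)) (bigor (neg t)).

Definition world := {t : {set seq_sub S} | `[< consistent t >]}.

Implicit Types (t u w : world) (A B C : form).

Lemma world_consistent t : consistent (val t).
Proof. by apply/asboolP; exact: (valP t). Qed.

Notation "t ||- A" := (holds (val t) A) (at level 30).

(* Lemmon's filtration condition, for [Box] and [Past] at once. *)
Definition prec : rel world := fun t u => all (fun A =>
  [&& t ||- A ==> u ||- A, t ||- Box A ==> u ||- A
    & (Past A \in S) && t ||- A ==> u ||- Past A]) S.

(** Bounding by [S] is harmless: held formulas lie in [S], and closure puts [A] there when [Box A]
    is held. *)
Lemma precP t u : reflect
  [/\ forall A, t ||- A -> u ||- A,
      forall A, t ||- Box A -> u ||- A &
      forall A, Past A \in S -> t ||- A -> u ||- Past A] (prec t u).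
Proof.
apply: (iffP allP) => [tu|[tu tbu tpu] A AS].
  split=> A.
  - by move=> tA; have /and3P[/implyP->] := tu A (holds_in tA).
  - move=> tA; have AS : A \in S := S_closed (holds_in tA).
    by have /and3P[_ /implyP->] := tu A AS.
  - move=> AS tA; have /and3P[_ _ /implyP->//] := tu A (holds_in tA).
    by rewrite AS.
by apply/and3P; split; apply/implyP; [exact: tu|exact: tbu|case/andP; exact: tpu].
Qed.

(** Whatever [u] gains from [t] persists in [w] by the first clause. *)
Lemma prec_trans : transitive prec.
Proof.
move=> u t w /precP[tu tbu tpu] /precP[uw ubw upw]; apply/precP; split=> A.
- by move/tu/uw.
- by move/tbu/uw.
- by move=> AS /(tpu _ AS)/uw.
Qed.

Definition canonical_frame := TFrame prec_trans.

(** [G] and [D] may leave [S], as [future] and [past] do. The world is the trace on [S] of a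
    saturated left side: its [pos] lies in [G'] and its [neg] in [D'], so consistency is
    inherited. *)
Lemma extend_world G D : ~ entails (bigand G) (bigor D) ->
  exists w, (forall A, A \in S -> A \in G -> w ||- A) /\
            (forall A, A \in D -> ~~ (w ||- A)).
Proof.
move=> /(saturate S)[G' [D' [GG' DD' GD' SGD]]].
pose t := [set a : seq_sub S | ssval a \in G'].
have holds_t A : holds t A = (A \in S) && (A \in G').
  apply/idP/andP => [tA|[AS AG]].
    split; first exact: holds_in tA.
    by case/exists_inP: tA => a; rewrite inE => aG /eqP<-.
  by apply/exists_inP; exists (SeqSub AS); rewrite ?inE.
have tcons : `[< consistent t >].
  apply/asboolP => tt; apply: GD'; apply: (@entails_trans (bigand (pos t))).
    by apply: sub_bigand => A; rewrite mem_pos holds_t => /andP[_]; exact.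
  apply: entails_trans tt (sub_bigor _) => A; rewrite mem_neg holds_t.
  by case/andP => + AS; rewrite AS /=; have /orP[->|] := SGD A AS.
exists (exist _ t tcons); split=> A /=; rewrite holds_t.
  by move=> -> /GG'.
move=> /DD' AD; apply/negP => /andP[_ AG]; apply: GD'.
exact: entails_trans (bigand_entails AG) (entails_bigor AD).
Qed.

(** Otherwise [A] would be in [neg], against consistency. *)
Lemma holds_closed t A : A \in S -> entails (bigand (pos (val t))) A -> t ||- A.
Proof.
move=> AS tA; apply: contrapT => /negP ntA; apply: (@world_consistent t).
by apply: entails_trans tA (entails_bigor _); rewrite mem_neg ntA.
Qed.

(** Consistency has a disjunction on its right side, which makes every world prime within [S]. *)
Lemma holds_prime t A B : A \in S -> B \in S ->
  entails (bigand (pos (val t))) (Or A B) -> t ||- A \/ t ||- B.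
Proof.
move=> AS BS tAB; apply/orP; apply: contrapT => /negP; rewrite negb_or.
case/andP => ntA ntB; apply: (@world_consistent t); apply: entails_trans tAB _.
by apply: entails_or; apply: entails_bigor; rewrite mem_neg ?ntA ?ntB.
Qed.

Lemma pos_entails t A : t ||- A -> entails (bigand (pos (val t))) A.
Proof. by move=> tA; apply: bigand_entails; rewrite mem_pos. Qed.

Lemma holds_le t A B : B \in S -> entails A B -> t ||- A -> t ||- B.
Proof.
by move=> BS AB tA; apply: holds_closed => //; exact: entails_trans (pos_entails tA) AB.
Qed.

(** The formulas that a [prec]-successor of [t] is obliged to contain; a [Past A] outside [S]
    imposes nothing. *)
Definition future t :=
  pos (val t) ++ [seq A <- S | t ||- Box A] ++ [seq Past A | A <- pos (val t)].

(** The three groups use [p -> □p], the boxed formula held by [t] itself, and the unit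
    [p -> □◆p]. *)
Lemma pos_entails_future t : entails (bigand (pos (val t))) (Box (bigand (future t))).
Proof.
apply: entails_box_bigand => A; rewrite !mem_cat => /or3P[].
- by move=> /bigand_entails tA; exact: entails_trans tA (entails_boxT _).
- by rewrite mem_filter => /andP[tA _]; exact: pos_entails.
- by case/mapP => B /bigand_entails tB ->; exact: entails_trans tB (entails_box_past _).
Qed.

Lemma prec_future t u :
  (forall A, A \in S -> A \in future t -> u ||- A) -> prec t u.
Proof.
move=> tu; apply/precP; split=> A.
- by move=> tA; apply: tu; rewrite ?(holds_in tA) // !mem_cat mem_pos tA.
- move=> tA; have AS : A \in S := S_closed (holds_in tA).
  by apply: tu => //; rewrite !mem_cat; apply/or3P/Or32; rewrite mem_filter tA.
- by move=> AS tA; apply: tu => //; rewrite !mem_cat map_f ?orbT // mem_pos.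
Qed.

(** Dual to [future]: the formulas that a [prec]-predecessor of [t] must omit. *)
Definition past t :=
  neg (val t) ++ [seq Box A | A <- neg (val t)] ++ [seq A <- S | Past A \in neg (val t)].

(** The three groups use [p -> □p], monotonicity of the box, and the adjunction. *)
Lemma past_entails_neg t : entails (bigor (past t)) (Box (bigor (neg (val t)))).
Proof.
apply: bigor_entails => A; rewrite !mem_cat => /or3P[].
- by move=> /entails_bigor At; exact: entails_trans At (entails_boxT _).
- by case/mapP => B /entails_bigor Bt ->; exact: entails_box.
- by rewrite mem_filter => /andP[/entails_bigor/entails_past_box].
Qed.

Lemma prec_past t u : (forall A, A \in past t -> ~~ (u ||- A)) -> prec u t.
Proof.
move=> tu; apply/precP; split=> A.
- move=> uA; apply: contraTT uA => tA.
  have [AS|] := boolP (A \in S); last by apply: contra; exact: holds_in.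
  by apply: tu; rewrite !mem_cat mem_neg tA AS.
- move=> uA; have AS : A \in S := S_closed (holds_in uA).
  apply: contraTT uA => tA.
  by apply: tu; rewrite !mem_cat map_f ?orbT // mem_neg tA.
- move=> PAS uA; have AS := holds_in uA; apply: contraTT uA => tA.
  by apply: tu; rewrite !mem_cat; apply/or3P/Or33; rewrite mem_filter mem_neg tA PAS.
Qed.

(** * The truth lemma, one connective at a time *)

Lemma holds_and t A B : And A B \in S -> (t ||- And A B) = (t ||- A) && (t ||- B).
Proof.
move=> ABS; have [AS BS] := S_closed ABS; apply/idP/andP => [tAB|[tA tB]].
  by split; apply: holds_le tAB => //; [exact: entails_andl|exact: entails_andr].
by apply: holds_closed => //; apply: entails_and; exact: pos_entails.
Qed.

Lemma holds_or t A B : Or A B \in S -> (t ||- Or A B) = (t ||- A) || (t ||- B).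
Proof.
move=> ABS; have [AS BS] := S_closed ABS; apply/idP/orP => [/pos_entails|].
  exact: holds_prime.
by case; apply: holds_le => //; [exact: entails_orl|exact: entails_orr].
Qed.

Lemma holds_imp t A B : Imp A B \in S ->
  (t ||- Imp A B) = [forall u, ((u == t) || prec t u) && (u ||- A) ==> (u ||- B)].
Proof.
move=> ABS; have [AS BS] := S_closed ABS; apply/idP/forallP => [tAB u|tAB].
  apply/implyP => /andP[tu uA].
  have uAB : u ||- Imp A B.
    by case/orP: tu => [/eqP->//|/precP[tu _ _]]; exact: tu.
  apply: holds_closed => //; apply: entails_mp (pos_entails uA).
  exact: pos_entails.
(* When [t] holds [A], the reflexive point gives [B], which entails the implication; otherwise a
   [prec]-successor holding [A] but not [B] is built. *)
have [tA|ntA] := boolP (t ||- A).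
  have /implyP := tAB t; rewrite eqxx tA => /(_ isT); apply: holds_le => //.
  exact/entails_imp/entails_andl.
apply: contrapT => /negP ntAB.
(* If this pair were derivable, [□p -> q \/ (q -> p)], with the conjunction of [future t] for [p]
   and [A] for [q], would make [t] entail [Or A (Imp A B)]. Primeness would then put [A] or
   [Imp A B] in [t], and both are excluded. *)
have [|u [fu uB]] := @extend_world (A :: future t) [:: B].
  move=> fAB; have [||||] // := @holds_prime t A (Imp A B).
  - apply: entails_trans (pos_entails_future t) _.
    apply: entails_trans (entails_box_imp _ A) _; apply: entails_or.
      exact: entails_orl.
    apply: entails_trans (entails_orr _ _); apply: entails_imp.
    apply: (@entails_trans (bigor [:: B])); last first.
      by apply: entails_or; [exact: entails_refl|exact: entails_bot].
    apply: entails_trans fAB; apply: entails_and; first exact: entails_andr.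
    exact: entails_mp (entails_andl _ _) (entails_andr _ _).
  - by rewrite (negPf ntA).
  - by rewrite (negPf ntAB).
have /negP := uB B (mem_head _ _); apply; apply: (implyP (tAB u)).
rewrite fu ?mem_head // andbT; apply/orP; right; apply: prec_future => C CS Ct.
by apply: fu => //; rewrite inE Ct orbT.
Qed.

Lemma holds_box t A : Box A \in S ->
  (t ||- Box A) = [forall u, prec t u ==> (u ||- A)].
Proof.
move=> ABS; apply/idP/forallP => [tA u|tA].
  by apply/implyP => /precP[_ tu _]; exact: tu.
apply: contrapT => /negP ntA.
(* Otherwise [future t] entails [A], and boxing both sides makes [t] entail [Box A]. *)
have [|u [fu uA]] := @extend_world (future t) [:: A].
  move=> fA; have /negP := ntA; apply; apply: holds_closed => //.
  apply: entails_trans (pos_entails_future t) (entails_box _).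
  by apply: entails_trans fA (entails_or _ _); [exact: entails_refl|exact: entails_bot].
have /negP := uA A (mem_head _ _); apply; apply: (implyP (tA u)).
exact: prec_future.
Qed.

Lemma holds_past t A : Past A \in S ->
  (t ||- Past A) = [exists u, (u ||- A) && prec u t].
Proof.
move=> PAS; have AS : A \in S := S_closed PAS.
apply/idP/existsP => [tA|[u /andP[uA /precP[_ _ ut]]]]; last exact: ut.
(* Otherwise [A] entails the box of the disjunction of [neg (val t)]; by adjunction [Past A] entails
   that disjunction, so [t] is inconsistent. *)
have [|u [Au pu]] := @extend_world [:: A] (past t).
  move=> Ap; apply: (@world_consistent t); apply: entails_trans (pos_entails tA) _.
  apply/entails_past_box; apply: entails_trans (past_entails_neg t).
  apply: entails_trans Ap; apply: entails_and; first exact: entails_refl.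
  exact: entails_top.
by exists u; rewrite Au ?mem_head // prec_past.
Qed.

Fact canonical_val_subproof n :
  is_upset ([set t | t ||- Var n] : {set canonical_frame}).
Proof. by apply/is_upsetP => t u /precP[tu _ _]; rewrite !inE; exact: tu. Qed.

Definition canonical_val n : upset canonical_frame := Upset (canonical_val_subproof n).

Lemma truth A t : A \in S -> (t \in uset (eval canonical_val A)) = (t ||- A).
Proof.
elim: A t => [n|||B IHB C IHC|B IHB C IHC|B IHB C IHC|B IHB|B IHB] t AS /=.
- by rewrite inE.
- rewrite inE; apply/esym/negbTE/negP => tbot; apply: (@world_consistent t).
  exact: entails_trans (pos_entails tbot) (entails_bot _).
- by rewrite inE; apply/esym/holds_closed => //; exact: entails_top.
- by have [BS CS] := S_closed AS; rewrite inE IHB // IHC // holds_and.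
- by have [BS CS] := S_closed AS; rewrite inE IHB // IHC // holds_or.
- have [BS CS] := S_closed AS; rewrite inE holds_imp //.
  by apply: eq_forallb => u; rewrite IHB // IHC.
- have BS : B \in S := S_closed AS; rewrite inE holds_box //.
  by apply: eq_forallb => u; rewrite IHB.
- have BS : B \in S := S_closed AS; rewrite inE holds_past //.
  by apply: eq_existsb => u; rewrite IHB.
Qed.

End Canonical.

(** * Completeness *)

Lemma tHC_complete_finite A :
  (forall (d : Order.disp_t) (H : temporalHeytingType d),
     finite_set [set: H]%classic -> valid H A) -> tHC A.
Proof.
move=> Afin; apply: contrapT => nA.
pose S_closed := @subforms_closed A.
(* The empty left side stands for [Top], so a non-theorem [A] is omitted by some world over its
   subformulas; by [truth], validity of [A] in the finite algebra of upsets would put it there. *)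
have [|w [_ wA]] := @extend_world (subforms A) [::] [:: A].
  move=> TA; apply: nA; apply: (@tHC_mp Top); last exact/tHC_mHC/mHC_IPC/IPC_top.
  by apply: entails_trans TA (entails_or _ _); [exact: entails_refl|exact: entails_bot].
have /negP := wA A (mem_head _ _); apply.
rewrite -(truth S_closed) ?mem_subforms // Afin ?inE //; exact: finite_finset.
Qed.

Theorem theorem6p12 (A : form) :
  tHC A <->
  (forall (d : Order.disp_t) (H : temporalHeytingType d),
     finite_set [set: H]%classic -> subdirectly_irreducible H -> valid H A).
Proof.
split=> [HA d H _ _|Asi]; first exact: tHC_sound.
exact/tHC_complete_finite/valid_finite_of_si.
Qed.
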